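(* Let $t\in\mathbb{R}\setminus\{0\}$. The sequence $(q_m(x;t))_{m\ge 0}$ of partial sums $q_m(x;t)=\sum_{n=0}^m t^n\alpha_n p_n(x)$ satisfies, for all integers $m\ge 0$, the four-term recursion $$\frac{a_m}{\alpha_{m+1}}\, q_{m+1}(x;t) + \frac{t\alpha_{m+1}(b_m-x)-a_m\alpha_m}{\alpha_m\alpha_{m+1}}\, q_m(x;t) + t\,\frac{t c_m\alpha_m-\alpha_{m-1}(b_m-x)}{\alpha_{m-1}\alpha_m}\, q_{m-1}(x;t) - \frac{t^2 c_m}{\alpha_{m-1}}\, q_{m-2}(x;t)=0,$$ with initial values $q_{-2}(x;t)=q_{-1}(x;t)=0$, $q_0(x;t)=1$.
   Context: Let $(a_n)_{n\ge0}$, $(b_n)_{n\ge0}$, $(c_n)_{n\ge1}$ be real sequences with $a_n\neq 0$ for all $n$. The polynomials $p_n$ (of degree $n$) are determined by $x\,p_n(x)=a_n p_{n+1}(x)+b_n p_n(x)+c_n p_{n-1}(x)$ for $n\ge 0$, with $p_{-1}(x)=0$, $p_0(x)=1$. Let $(\alpha_n)_{n\ge0}$ be a sequence of nonzero real numbers with $\alpha_0=1$. In the recursion for $m=0$ the terms containing $q_{-1}$ and $q_{-2}$ are read as zero (the symbols $c_0$ and $\alpha_{-1}\ne0$ occurring there may be given arbitrary values); likewise the term $c_0p_{-1}$ is zero. *)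

(* Defs.v *)
From mathcomp Require Import all_boot all_order all_algebra.
From mathcomp Require Import reals.
Set Implicit Arguments.
Unset Strict Implicit.
Unset Printing Implicit Defensive.
Import Order.TTheory GRing.Theory Num.Theory.
Local Open Scope ring_scope.

(* The family is indexed by [int] so that p_{-1} = 0 can be imposed literally;
   [p k] is unconstrained for k < -1, and [c 0] is irrelevant. The
   property size (p n) = n.+1 (degree n) follows when all a n are nonzero. *)
Definition three_term_family (R : realType) (a b c : nat -> R)
    (p : int -> {poly R}) : Prop :=
  [/\ p (-1) = 0, p 0 = 1 &
      forall n : nat,
        'X * p n%:Z =
          a n *: p (n%:Z + 1) + b n *: p n%:Z + c n *: p (n%:Z - 1)].

Definition partial_sum (R : realType) (t : R) (alpha : int -> R)
    (p : int -> {poly R}) (m : int) : {poly R} :=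
  match m with
  | Posz k => \sum_(0 <= n < k.+1) (t ^+ n * alpha n%:Z) *: p n%:Z
  | Negz _ => 0
  end.

(* Main.v *)
Require Import Defs.
From mathcomp Require Import all_boot all_order all_algebra.
From mathcomp Require Import reals.
From mathcomp Require Import ring.
Set Implicit Arguments.
Unset Strict Implicit.
Unset Printing Implicit Defensive.
Import Order.TTheory GRing.Theory Num.Theory.
Local Open Scope ring_scope.

(** Consecutive partial sums differ by a single term,
    [q_k - q_(k-1) = t^k alpha_k p_k], and the coefficients of the four-term
    recursion are arranged so that its left-hand side is a combination of
    three consecutive differences:
    [(a_m / alpha_(m+1)) (q_(m+1) - q_m)
     + (t / alpha_m) (b_m - X) (q_m - q_(m-1))
     + (t^2 c_m / alpha_(m-1)) (q_(m-1) - q_(m-2))].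
    Inserting the differences cancels the [alpha]s and leaves
    [t^(m+1) (a_m p_(m+1) + (b_m - X) p_m + c_m p_(m-1))], which vanishes by
    the three-term recurrence.  The regrouping is [four_term_regroup], the
    difference formula is [partial_sumB]. *)

(** Allowing [k = -1], with [t ^ k] an integer power, is what makes the case
    [m = 0] of the recursion an instance of the general one: there the
    difference [q_(-1) - q_(-2)] is [0] and so is [t^(-1) alpha_(-1) p_(-1)]. *)
Lemma partial_sumB (R : realType) (t : R) (alpha : int -> R)
    (p : int -> {poly R}) (k : int) :
  p (-1) = 0 -> -1 <= k ->
  partial_sum t alpha p k - partial_sum t alpha p (k - 1)
    = (t ^ k * alpha k) *: p k.
Proof.
move=> pN1; case: k => [[|n]|[|n]] // _.
- by rewrite sub0r /= big_nat1 subr0.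
- have -> : n.+1%:Z - 1 = n%:Z by rewrite -addn1 PoszD addrK.
  by rewrite /= big_nat_recr //= addrAC subrr add0r.
- by rewrite pN1 scaler0 subrr.
Qed.

(** The two middle coefficients split into partial fractions, and each half
    pairs with one of the neighbouring terms. *)
Lemma four_term_regroup (F : fieldType) (a c t al1 al0 alN1 : F)
    (d q1 q0 qN1 qN2 : {poly F}) :
  al1 != 0 -> al0 != 0 -> alN1 != 0 ->
  (a / al1) *: q1
  + (al0 * al1)^-1 *: ((t * al1) *: d - (a * al0)%:P) * q0
  + (t / (alN1 * al0)) *: ((t * c * al0)%:P - alN1 *: d) * qN1
  - (t ^+ 2 * c / alN1) *: qN2
  = (a / al1) *: (q1 - q0) + (t / al0) *: (d * (q0 - qN1))
    + (t ^+ 2 * c / alN1) *: (qN1 - qN2).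
Proof.
move=> al1_neq0 al0_neq0 alN1_neq0.
have -> : (al0 * al1)^-1 *: ((t * al1) *: d - (a * al0)%:P)
    = (t / al0) *: d - (a / al1)%:P.
  rewrite scalerBr scalerA -mul_polyC -[_ *: _%:P]mul_polyC -polyCM mul_polyC.
  by congr (_ *: _ - _%:P); field; apply/andP.
have -> : (t / (alN1 * al0)) *: ((t * c * al0)%:P - alN1 *: d)
    = (t ^+ 2 * c / alN1)%:P - (t / al0) *: d.
  rewrite scalerBr scalerA -[_ *: _%:P]mul_polyC -polyCM.
  by congr (_%:P - _ *: _); field; apply/andP.
rewrite -!mul_polyC; ring.
Qed.

Theorem lemma2p1 (R : realType) (a b c : nat -> R) (p : int -> {poly R})
    (alpha : int -> R) (t : R)
    (a_neq0 : forall n : nat, a n != 0)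
    (p_rec : three_term_family a b c p)
    (alpha_neq0 : forall n : int, -1 <= n -> alpha n != 0)
    (alpha0 : alpha 0 = 1)
    (t_neq0 : t != 0) :
  let q := partial_sum t alpha p in
  [/\ q (-2) = 0, q (-1) = 0, q 0 = 1 &
      forall m : nat,
        (a m / alpha (m%:Z + 1)) *: q (m%:Z + 1)
        + (alpha m%:Z * alpha (m%:Z + 1))^-1 *:
            ((t * alpha (m%:Z + 1)) *: ((b m)%:P - 'X)
             - (a m * alpha m%:Z)%:P) * q m%:Z
        + (t / (alpha (m%:Z - 1) * alpha m%:Z)) *:
            ((t * c m * alpha m%:Z)%:P
             - alpha (m%:Z - 1) *: ((b m)%:P - 'X)) * q (m%:Z - 1)
        - (t ^+ 2 * c m / alpha (m%:Z - 1)) *: q (m%:Z - 2)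
        = 0].
Proof.
case: p_rec => pN1 p0 p_step q; split=> [//|//||m].
  by rewrite /q /= big_nat1 expr0 alpha0 mulr1 scale1r p0.
have al1_neq0 : alpha (m%:Z + 1) != 0 by apply: alpha_neq0.
have al0_neq0 : alpha m%:Z != 0 by apply: alpha_neq0.
have leN1 : -1 <= m%:Z - 1 by rewrite lerBrDr addNr.
have alN1_neq0 : alpha (m%:Z - 1) != 0 by apply: alpha_neq0.
rewrite four_term_regroup //.
have -> : q (m%:Z + 1) - q m%:Z
    = (t ^ (m%:Z + 1) * alpha (m%:Z + 1)) *: p (m%:Z + 1).
  by rewrite -partial_sumB // addrK.
have -> : q (m%:Z - 1) - q (m%:Z - 2)
    = (t ^ (m%:Z - 1) * alpha (m%:Z - 1)) *: p (m%:Z - 1).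
  by rewrite -partial_sumB // -addrA -opprD.
rewrite partial_sumB // -scalerAr !scalerA !expfzDr // expr1z exprN1.
set T := t ^ m%:Z.
have -> : a m / alpha (m%:Z + 1) * (T * t * alpha (m%:Z + 1)) = T * t * a m.
  by field.
have -> : t / alpha m%:Z * (T * alpha m%:Z) = T * t by field.
have -> : t ^+ 2 * c m / alpha (m%:Z - 1) * (T / t * alpha (m%:Z - 1))
    = T * t * c m.
  by field; apply/andP.
rewrite mulrBl p_step -!mul_polyC !polyCM; ring.
Qed.
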